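(* Let $G$ be a connected non-compact real semisimple Lie group, $\sigma$ an involutive automorphism of $G$, and $H$ a closed subgroup of $G$ with $(G^\sigma)_0\subset H\subset G^\sigma$. Let $\theta$ be a Cartan involution of $G$ commuting with $\sigma$, $K=G^\theta$, $K_H=K\cap H$, $\mathfrak a_0$ a maximal abelian subspace of $\mathfrak p_0\cap\mathfrak q_0$, and $A=\exp\mathfrak a_0$. Let $\Delta:G\to G\times G$, $\Delta(g)=(g,g)$. Then $\Delta(N_{K_H}(A))=N_{K\times H}(A)$; hence there is a group isomorphism $N_{K\times H}(A)\simeq N_{K_H}(A)$. Similarly, $Z_{K\times H}(A)\simeq Z_{K_H}(A)$ as groups.
   Context: For an automorphism $\nu$ of $G$, $G^\nu=\{g\in G:\nu(g)=g\}$, and $(G^\nu)_0$ is its identity component. The differentials of $\sigma,\theta$ on the Lie algebra $\mathfrak g_0$ of $G$ are denoted by the same letters. $\mathfrak p_0=\{X\in\mathfrak g_0:\theta(X)=-X\}$ and $\mathfrak q_0=\{X\in\mathfrak g_0:\sigma(X)=-X\}$. The group $K=G^\theta$ is connected and is a maximal compact subgroup of $G$. A maximal abelian subspace of $\mathfrak p_0\cap\mathfrak q_0$ is an abelian subspace that is maximal among abelian subspaces contained in $\mathfrak p_0\cap\mathfrak q_0$. Actions and groups: $G\times G$ acts on $G$ by $(g_1,g_2)\cdot x=g_1xg_2^{-1}$, and $G$ acts on $G$ by $g\cdot x=gxg^{-1}$. Define $N_{K\times H}(A)=\{(k,h)\in K\times H:(k,h)\cdot A=A\}$, $Z_{K\times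 H}(A)=\{(k,h)\in K\times H:(k,h)\cdot a=a\ \text{for all } a\in A\}$, $N_{K_H}(A)=\{k\in K_H: k\cdot A=A\}$, $Z_{K_H}(A)=\{k\in K_H: k\cdot a=a\ \text{for all } a\in A\}$. *)

(* Defs.v *)
From HB Require Import structures.
From mathcomp Require Import all_boot all_order all_algebra.
From mathcomp Require Import all_classical all_reals all_analysis.

Set Implicit Arguments.
Unset Strict Implicit.
Unset Printing Implicit Defensive.

Import Order.TTheory GRing.Theory Num.Theory.
Import numFieldNormedType.Exports.

Local Open Scope classical_set_scope.
Local Open Scope ring_scope.

(* [Ck_on k U f] : f is of class C^k on U. It is only meant for open U, where
   'D_v f on U depends on f only through its values on U. *)
Fixpoint Ck_on (R : realType) (V W : normedModType R) (k : nat)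
    (U : set V) (f : V -> W) : Prop :=
  if k is k'.+1 then
    (forall x, U x -> differentiable f x) /\
    (forall v, Ck_on k' U ('D_v f))
  else forall x, U x -> {for x, continuous f}.

Definition smooth_on (R : realType) (V W : normedModType R)
    (U : set V) (f : V -> W) : Prop := forall k, Ck_on k U f.

(* A chart of M modelled on V: [cmap] and [cinv] are total functions whose
   values matter only on [cdom] and [ccod] respectively. *)
Record chart (V M : Type) := Chart {
  cdom : set M;
  ccod : set V;
  cmap : M -> V;
  cinv : V -> M }.

Definition is_chart (V M : topologicalType) (c : chart V M) : Prop :=
  [/\ open (cdom c) /\ open (ccod c),
      set_fun (cdom c) (ccod c) (cmap c) /\ set_fun (ccod c) (cdom c) (cinv c),
      {in cdom c, cancel (cmap c) (cinv c)} /\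
      {in ccod c, cancel (cinv c) (cmap c)},
      forall x, cdom c x -> {for x, continuous (cmap c)} &
      forall p, ccod c p -> {for p, continuous (cinv c)}].

Definition id_chart (V : Type) : chart V V := Chart setT setT id id.

Definition prod_chart (V W M N : Type) (c : chart V M) (d : chart W N) :
    chart (V * W) (M * N) :=
  Chart (cdom c `*` cdom d) (ccod c `*` ccod d)
    (fun x => (cmap c x.1, cmap d x.2)) (fun p => (cinv c p.1, cinv d p.2)).

(* Smoothness of f : M -> N, where M and N carry the atlases a and b. *)
Definition smooth_map (R : realType) (V W : normedModType R)
    (M N : topologicalType) (I J : Type)
    (a : I -> chart V M) (b : J -> chart W N) (f : M -> N) : Prop :=
  continuous f /\
  forall i j, smooth_on
    [set p | ccod (a i) p /\ cdom (b j) (f (cinv (a i) p))]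
    (cmap (b j) \o f \o cinv (a i)).

(* The atlas is presented as a family of charts indexed by the points of M,
   the chart [chart_at x] being one whose domain contains x. *)
HB.mixin Record isManifold (R : realType) (n : nat) M of Topological M := {
  chart_at : M -> chart 'rV[R]_n M;
  chart_atP : forall x, is_chart (chart_at x);
  mem_chart_at : forall x, cdom (chart_at x) x;
  chart_at_compatible : smooth_map chart_at chart_at id;
  manifold_hausdorff : hausdorff_space M;
  manifold_second_countable : @second_countable M
}.

#[short(type="manifoldType")]
HB.structure Definition Manifold (R : realType) (n : nat) :=
  { M of Topological M & isManifold R n M }.

HB.mixin Record isLieGroup (R : realType) (n : nat) G
    of Manifold R n G & Group G := {
  smooth_mulg : smooth_map
    (fun x : G * G => prod_chart (chart_at x.1) (chart_at x.2)) chart_at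
    (fun x : G * G => (x.1 * x.2)%g);
  smooth_invg : smooth_map chart_at chart_at (fun x : G => (x^-1)%g)
}.

#[short(type="lieGroupType")]
HB.structure Definition LieGroup (R : realType) (n : nat) :=
  { G of Manifold R n G & Group G & isLieGroup R n G }.

Definition is_subgroup (G : groupType) (H : set G) : Prop :=
  group_closed (mem H).

(* Lie algebras with underlying space R^n, given by their bracket. *)
Section LieAlgebra.
Context {R : realType} {n : nat}.
Variable br : 'rV[R]_n -> 'rV[R]_n -> 'rV[R]_n.

Definition lie_ideal (U : {vspace 'rV[R]_n}) : Prop :=
  forall x u, u \in U -> br x u \in U.

(* [U, U]: as br is bilinear, it is spanned by the brackets of a basis. *)
Definition derived_vspace (U : {vspace 'rV[R]_n}) : {vspace 'rV[R]_n} :=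
  <<[seq br u v | u <- vbasis U, v <- vbasis U]>>%VS.

Definition solvable_vspace (U : {vspace 'rV[R]_n}) : Prop :=
  exists k, iter k derived_vspace U = 0%VS.

Definition semisimple_lie_algebra : Prop :=
  forall U, lie_ideal U -> solvable_vspace U -> U = 0%VS.

Definition killing_form (X Y : 'rV[R]_n) : R := \tr (lin1_mx (br X \o br Y)).

Definition cartan_involution (t : 'rV[R]_n -> 'rV[R]_n) : Prop :=
  [/\ linear t, {morph t : X Y / br X Y}, involutive t &
      forall X, X != 0 -> 0 < - killing_form X (t X)].

Definition abelian_vspace (U : {vspace 'rV[R]_n}) : Prop :=
  forall X Y, X \in U -> Y \in U -> br X Y = 0.

Definition maximal_abelian_in (S : set 'rV[R]_n) (U : {vspace 'rV[R]_n}) :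
    Prop :=
  [/\ [set` U] `<=` S, abelian_vspace U &
      forall U' : {vspace 'rV[R]_n}, [set` U'] `<=` S -> abelian_vspace U' ->
        (U <= U')%VS -> U' = U].

End LieAlgebra.

(* The Lie algebra of G is the tangent space at 1, identified with 'rV[R]_n by
   means of the chart [chart_at 1]. *)
Section LieGroupTheory.
Context {R : realType} {n : nat}.
Variable G : lieGroupType R n.
Implicit Types (X Y : 'rV[R]_n) (f : G -> G).

Definition chart1 : chart 'rV[R]_n G := chart_at (1%g : G).
Definition origin : 'rV[R]_n := cmap chart1 1%g.

(* The differential at 1 of a map f such that f 1 = 1. *)
Definition differential1 f : 'rV[R]_n -> 'rV[R]_n :=
  'd (cmap chart1 \o f \o cinv chart1) origin.

(* The left-invariant vector field with value X at 1, in the chart at 1: its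
   value at p is the image of X under the differential at 1 of the left
   translation by [cinv chart1 p]. *)
Definition left_invariant_field X (p : 'rV[R]_n) : 'rV[R]_n :=
  'D_X (fun q => cmap chart1 (cinv chart1 p * cinv chart1 q)%g) origin.

Definition vector_field_bracket (v w : 'rV[R]_n -> 'rV[R]_n) (p : 'rV[R]_n) :
    'rV[R]_n :=
  'D_(v p) w p - 'D_(w p) v p.

Definition lie_bracket X Y : 'rV[R]_n :=
  vector_field_bracket (left_invariant_field X) (left_invariant_field Y) origin.

Definition one_parameter_subgroup (c : R^o -> G) X : Prop :=
  [/\ smooth_map (fun _ : unit => id_chart R^o) chart_at c,
      {morph c : s t / s + t >-> (s * t)%g} &
      'D_1 (cmap chart1 \o c) 0 = X].

(* There is exactly one c such that [one_parameter_subgroup c X], so that the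
   default value of xget is never used. *)
Definition lie_exp X : G :=
  xget 1%g [set g | exists2 c, one_parameter_subgroup c X & g = c 1].

Definition semisimple_lie_group : Prop :=
  connected [set: G] /\ semisimple_lie_algebra lie_bracket.

Definition lie_group_automorphism f : Prop :=
  {morph f : x y / (x * y)%g} /\
  exists f', [/\ cancel f f', cancel f' f,
    smooth_map (@chart_at R n G) (@chart_at R n G) f &
    smooth_map (@chart_at R n G) (@chart_at R n G) f'].

Definition involutive_automorphism f : Prop :=
  lie_group_automorphism f /\ involutive f.

Definition group_cartan_involution f : Prop :=
  involutive_automorphism f /\ cartan_involution lie_bracket (differential1 f).

Definition fixed_points f : set G := [set x | f x = x].

Definition minus_eigenspace f : set 'rV[R]_n :=
  [set X | differential1 f X = - X].

Definition maximal_compact_subgroup (K : set G) : Prop :=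
  [/\ is_subgroup K, compact K &
      forall L : set G, is_subgroup L -> compact L -> K `<=` L -> L = K].

Definition two_sided_action (g : G * G) (x : G) : G := (g.1 * x * g.2^-1)%g.

Definition conjugation_action (g x : G) : G := (g * x * g^-1)%g.

End LieGroupTheory.

Definition setwise_stabilizer (T M : Type) (act : T -> M -> M)
    (S : set T) (A : set M) : set T :=
  [set g | S g /\ act g @` A = A].

Definition pointwise_stabilizer (T M : Type) (act : T -> M -> M)
    (S : set T) (A : set M) : set T :=
  [set g | S g /\ forall a, A a -> act g a = a].

(* A and B are subgroups of the ambient groups and are isomorphic as groups. *)
Definition isomorphic_subgroups (G1 G2 : groupType) (A : set G1) (B : set G2) :
    Prop :=
  [/\ is_subgroup A, is_subgroup B &
      exists2 f : G1 -> G2,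
        set_bij A B f & {in A &, {morph f : x y / (x * y)%g}}].

(* Main.v *)
Require Import Defs.
From HB Require Import structures.
From mathcomp Require Import all_boot all_order all_algebra.
From mathcomp Require Import all_classical all_reals all_analysis.
From mathcomp Require Import ring.

Set Implicit Arguments.
Unset Strict Implicit.
Unset Printing Implicit Defensive.

Import Order.TTheory GRing.Theory Num.Theory.
Import numFieldNormedType.Exports.

Local Open Scope classical_set_scope.
Local Open Scope ring_scope.

(* If (k, h) in K x H stabilizes A, then a = k h^-1 lies in A because 1 does.
   One-parameter subgroups being determined by their tangent vectors, theta and
   sigma both invert a = exp Y; hence a^2 = k sigma(k)^-1 is fixed by theta as
   well as inverted by it, and a^4 = 1. For g = exp(tY) the operator Ad g is
   symmetric for the inner product -B(X, theta Y), so that Ad(g^2) is positive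
   and Ad(g^4) = 1 implies Ad(g^2) = 1. Descending through the dyadic
   fractions of the period, Ad(exp(tY)) = 1 for arbitrarily small t; thus
   [Y, -] = 0, B(Y, theta Y) = 0 and Y = 0. Therefore a = 1 and k = h. *)

(** * Second derivatives *)

(** The relation a^2 = k sigma(k)^-1 comes from k = a h: sigma inverts a and fixes h, so sigma(k) =
    a^-1 h. Powers of two are forced by the positivity argument: when Ad(g^4) = 1, the only possible
    eigenvalues of Ad(g^2) are 1 and -1, and -1 is excluded because Ad(g^2) is the square of a
    symmetric operator; so triviality of Ad passes from a time to its half. Symmetry of Ad g rests
    on the invariance of the Killing form, hence on Ad g preserving a bracket that is defined by
    left-invariant fields in the chart at 1. This is the source of the calculus below: that related
    fields have related brackets comes down to the symmetry of second derivatives. The small times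
    are turned into [Y, -] = 0 by comparing invariant fields: where Ad g fixes Z, the left- and
    right-invariant fields of Z agree at g, and [Y, Z] is the derivative at 0, along the
    one-parameter subgroup of Y, of the difference of these two fields. *)

Section Calculus.
Context {R : realType}.

(** Chart expressions of the same map coincide only near a point, so differentiability has to be
    carried along a local equality. *)
Lemma near_eq_differentiable {V W : normedModType R} (f g : V -> W) (x : V) :
  (\near x, f x = g x) -> differentiable f x -> differentiable g x.
Proof.
move=> fg df.
have dg : g \o shift x = cst (g x) + 'd f x +o_ 0 id.
  rewrite -(nbhs_singleton fg); apply/eqaddoP => e e0.
  have /eqaddoP/(_ e e0) := diff_locally df.
  apply: filter_app; near=> h.
  suff /= -> : (g \o shift x - (cst (f x) + 'd f x)) h
     = (f \o shift x - (cst (f x) + 'd f x)) h by [].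
  rewrite -![(_ - _ : _ -> _) _]/(_ - _) /=; congr (_ - _).
  by near: h; move: fg; rewrite (near_shift 0) subr0; apply: filterS => z /= ->.
have dfc : continuous ('d f x) by exact: diff_continuous.
by apply/diff_locallyP; rewrite (diff_unique dfc dg).
Unshelve. all: by end_near. Qed.

Lemma derive_comp {U V W : normedModType R} (f : U -> V) (g : V -> W) x v :
  differentiable f x -> differentiable g (f x) ->
  'D_v (g \o f) x = 'D_('D_v f x) g (f x).
Proof.
move=> df dg; rewrite !deriveE//; last exact: differentiable_comp.
by rewrite diff_comp.
Qed.

Lemma derive_is_linear {V W : normedModType R} (f : V -> W) x :
  differentiable f x -> linear (fun v => 'D_v f x).
Proof. by move=> df k u v; rewrite !deriveE// linearP. Qed.

Lemma derive_dirB {V W : normedModType R} (f : V -> W) x u v :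
  differentiable f x -> 'D_(u - v) f x = 'D_u f x - 'D_v f x.
Proof. by move=> df; rewrite !deriveE// linearB. Qed.

Lemma derive_line {V W : normedModType R} (f : V -> W) (u x : V) (a : R) :
  (fun h : R => h^-1 *: (f ((h *: (1 : R^o) + a) *: u + x) - f (a *: u + x))) =
  (fun h : R => h^-1 *: (f (h *: u + (a *: u + x)) - f (a *: u + x))).
Proof.
by apply/funext => h; rewrite scalerDl addrA [h *: 1]mulr1.
Qed.

Lemma is_derive_line {V W : normedModType R} (f : V -> W) (u x : V) (a : R) df :
  is_derive (a *: u + x) u f df ->
  is_derive a 1 (fun b : R => f (b *: u + x)) df.
Proof.
by move=> [fd <-]; split; rewrite /derivable /derive derive_line.
Qed.

(** The mean value theorem is applied twice: along [u] to the difference of [f] across the edge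
    [t *: v], then along [v] to [fu]. Each application contributes one factor [t]. *)
Lemma second_difference {V : normedModType R} (f fu fuv : V -> R) (x u v : V) t :
  0 < t ->
  (forall a b, 0 <= a <= t -> 0 <= b <= t ->
    is_derive (a *: u + (b *: v + x)) u f (fu (a *: u + (b *: v + x)))) ->
  (forall a b, 0 <= a <= t -> 0 <= b <= t ->
    is_derive (a *: u + (b *: v + x)) v fu (fuv (a *: u + (b *: v + x)))) ->
  exists a b, [/\ 0 <= a <= t, 0 <= b <= t &
    f (t *: u + (t *: v + x)) - f (t *: u + x) - (f (t *: v + x) - f x) =
    fuv (a *: u + (b *: v + x)) * t * t].
Proof.
move=> t0 dfu dfuv.
pose g a := f (a *: u + (t *: v + x)) - f (a *: u + x).
pose g' a := fu (a *: u + (t *: v + x)) - fu (a *: u + x).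
have dg a : a \in `[0, t] -> is_derive a 1 g (g' a).
  rewrite in_itv/= => at0; apply: is_deriveB; apply: is_derive_line.
    by apply: dfu => //; rewrite lexx ltW.
  by have := dfu a 0 at0; rewrite scale0r add0r; apply; rewrite lexx ltW.
have gd a : a \in `]0, t[ -> is_derive a 1 g (g' a).
  by move=> /subset_itv_oo_cc; exact: dg.
have gc : {within `[0, t], continuous g}.
  by apply: derivable_within_continuous => a /dg; case.
have [a /subset_itv_oo_cc aI gE] := MVT t0 gd gc.
have a0t : 0 <= a <= t by rewrite in_itv/= in aI.
move: gE; rewrite subr0 /g scale0r !add0r => ->.
pose h b := fu (b *: v + (a *: u + x)).
pose h' b := fuv (b *: v + (a *: u + x)).
have dh b : b \in `[0, t] -> is_derive b 1 h (h' b).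
  rewrite in_itv/= => bt0; apply: is_derive_line.
  by rewrite /h' addrCA; apply: dfuv.
have hd b : b \in `]0, t[ -> is_derive b 1 h (h' b).
  by move=> /subset_itv_oo_cc; exact: dh.
have hc : {within `[0, t], continuous h}.
  by apply: derivable_within_continuous => b /dh; case.
have [b /subset_itv_oo_cc bI hE] := MVT t0 hd hc.
have b0t : 0 <= b <= t by rewrite in_itv/= in bI.
move: hE; rewrite subr0 => hE.
exists a, b; split => //.
by rewrite /g' addrCA -/(h t) -[a *: u + x]add0r -(scale0r v) -/(h 0) hE /h' addrCA.
Qed.

Lemma near_parallelogram {V : normedModType R} (P : V -> Prop) (x u v : V) :
  (\near x, P x) ->
  exists2 t : R, 0 < t &
    forall a b, 0 <= a <= t -> 0 <= b <= t -> P (a *: u + (b *: v + x)).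
Proof.
move=> /nbhs_normP[r /= r0 rP].
have d0 : 0 < `|u| + `|v| + 1 by rewrite ltr_wpDl// addr_ge0.
(* Points of the parallelogram lie within t (|u| + |v|) of [x]; the added 1 makes this strictly less
   than [r] and keeps the denominator positive when [u] and [v] vanish. *)
exists (r / (`|u| + `|v| + 1)); first by rewrite divr_gt0.
move=> a b /andP[a0 at_] /andP[b0 bt]; apply: rP => /=.
rewrite addrA opprD addrCA subrr addr0 normrN.
rewrite (le_lt_trans (ler_normD _ _))// !normrZ !ger0_norm//.
apply: (@le_lt_trans _ _ (r / (`|u| + `|v| + 1) * (`|u| + `|v|))).
  by rewrite mulrDr lerD// ler_wpM2r.
by rewrite -mulrA gtr_pMr// ltr_pdivrMl// mulr1 ltrDl.
Qed.

(** The second difference over a parallelogram is symmetric in [u] and [v], so the two mixed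
    derivatives share a value, taken at two points arbitrarily near [x]; continuity does the
    rest. *)
Lemma schwarz_real {V : normedModType R} (f fu fv fuv fvu : V -> R) (x u v : V) :
  (\forall y \near x, [/\ is_derive y u f (fu y), is_derive y v f (fv y),
     is_derive y v fu (fuv y) & is_derive y u fv (fvu y)]) ->
  {for x, continuous fuv} -> {for x, continuous fvu} -> fuv x = fvu x.
Proof.
move=> df cuv cvu; apply/eqP; rewrite -subr_eq0; apply: contraT => D0.
(* Half the supposed gap, so that two errors below [e] cannot fill it. *)
pose e := `|fuv x - fvu x| / 2.
have e0 : 0 < e by rewrite divr_gt0// normr_gt0.
have nuv : \forall y \near x, `|fuv x - fuv y| < e by move/cvgrPdist_lt : cuv; exact.
have nvu : \forall y \near x, `|fvu x - fvu y| < e by move/cvgrPdist_lt : cvu; exact.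
have [t t0 H] := near_parallelogram u v (filterI (filterI df nuv) nvu).
have [a [b [aI bI E]]] : exists a b, [/\ 0 <= a <= t, 0 <= b <= t &
    f (t *: u + (t *: v + x)) - f (t *: u + x) - (f (t *: v + x) - f x) =
    fuv (a *: u + (b *: v + x)) * t * t].
  by apply: (second_difference (fu := fu)) => // a b aI bI; have [[[]]] := H a b aI bI.
have [a' [b' [aI' bI' E']]] : exists a b, [/\ 0 <= a <= t, 0 <= b <= t &
    f (t *: v + (t *: u + x)) - f (t *: v + x) - (f (t *: u + x) - f x) =
    fvu (a *: v + (b *: u + x)) * t * t].
  apply: (second_difference (fu := fv)) => // a' b' aI' bI';
    have [[[]]] := H b' a' bI' aI';
    by rewrite addrCA.
have {E E'} EE : fuv (a *: u + (b *: v + x)) = fvu (a' *: v + (b' *: u + x)).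
  apply: (mulIf (lt0r_neq0 t0)); apply: (mulIf (lt0r_neq0 t0)).
  by rewrite -E -E' [t *: v + (t *: u + x)]addrCA; ring.
have [[_ /= A] _] := H a b aI bI.
have [_ /= B] := H b' a' bI' aI'.
rewrite EE in A; rewrite addrCA in B.
have : `|fuv x - fvu x| < e + e.
  rewrite -(subrKA (fvu (a' *: v + (b' *: u + x)))).
  rewrite (le_lt_trans (ler_normD _ _))// ltrD// distrC //.
by rewrite -splitr ltxx.
Qed.

Lemma is_derive_coord {V : normedModType R} {m} (f : V -> 'rV[R]_m) x v j :
  differentiable f x ->
  is_derive x v (fun y => f y ord0 j) ('D_v f x ord0 j).
Proof.
move=> /(@diff_derivable _ _ _ _ _ v) df; split.
  by move/derivable_mxP : df => /(_ ord0 j).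
by rewrite (derive_mx df) mxE.
Qed.

(** Coordinates are treated one by one because the mean value theorem behind [schwarz_real] is for
    real-valued functions. *)
Lemma derive_comm {V : normedModType R} {m} (f : V -> 'rV[R]_m) U x u v :
  open U -> Ck_on 2 U f -> U x -> 'D_u ('D_v f) x = 'D_v ('D_u f) x.
Proof.
move=> oU [df d2f] Ux; apply/rowP => j.
apply: (@schwarz_real _ (fun y => f y ord0 j)
  (fun y => 'D_v f y ord0 j) (fun y => 'D_u f y ord0 j)
  (fun y => 'D_u ('D_v f) y ord0 j) (fun y => 'D_v ('D_u f) y ord0 j) x v u).
- have : \forall y \near x, U y by exact: open_nbhs_nbhs.
  apply: filterS => y Uy; split; apply: is_derive_coord; try exact: df.
  + exact: (d2f v).1.
  + exact: (d2f u).1.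
- apply: (@continuous_comp _ _ _ ('D_u ('D_v f)) (fun w : 'rV_m => w ord0 j)).
    exact: (d2f v).2.
  exact: coord_continuous.
- apply: (@continuous_comp _ _ _ ('D_v ('D_u f)) (fun w : 'rV_m => w ord0 j)).
    exact: (d2f u).2.
  exact: coord_continuous.
Qed.

Lemma derive_delta {W : normedModType R} {m} (F : 'rV[R]_m -> W) x v :
  differentiable F x ->
  'D_v F x = \sum_j v ord0 j *: 'D_(delta_mx ord0 j) F x.
Proof.
move=> dF; rewrite deriveE// {1}(row_sum_delta v) linear_sum.
by apply: eq_bigr => j _; rewrite linearZ/= deriveE.
Qed.

Lemma is_derive_scale {V : normedModType R} {m} (k : V -> R) (G : V -> 'rV[R]_m)
    x v dk dG :
  is_derive x v k dk -> is_derive x v G dG ->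
  is_derive x v (fun y => k y *: G y) (k x *: dG + dk *: G x).
Proof.
move=> dkx [dGx dGE].
have Gj j : is_derive x v (fun y => G y ord0 j) (dG ord0 j).
  split; first by move/derivable_mxP : dGx => /(_ ord0 j).
  by rewrite -dGE (derive_mx dGx) mxE.
have dkG i j : is_derive x v (fun y => (k y *: G y) i j)
    ((k x *: dG + dk *: G x) i j).
  rewrite (ord1 i) !mxE.
  rewrite (_ : (fun y => _) = k * (fun y => G y ord0 j)); last first.
    by apply/funext => y; rewrite mxE.
  by apply: is_derive_eq; rewrite /= [_ *: dk]mulrC.
have dkGx : derivable (fun y => k y *: G y) x v.
  by apply/derivable_mxP => i j; case: (dkG i j).
split => //; rewrite derive_mx//; apply/matrixP => i j.
by rewrite mxE derive_val.
Qed.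

(** The last hypothesis is differentiated in the direction [u]: by the chain rule on its right side,
    by the product rule on its left side, where [y] occurs both in the direction and in the base
    point. *)
Lemma derive_pushforward {m p} (F : 'rV[R]_m -> 'rV[R]_p) U
    (w : 'rV[R]_m -> 'rV[R]_m) (w' : 'rV[R]_p -> 'rV[R]_p) x u :
  open U -> Ck_on 2 U F -> U x ->
  differentiable w x -> differentiable w' (F x) ->
  (\forall y \near x, 'D_(w y) F y = w' (F y)) ->
  'D_('D_u F x) w' (F x) = 'D_('D_u w x) F x + 'D_u ('D_(w x) F) x.
Proof.
move=> oU [dF d2F] Ux dw dw' FE.
rewrite -(derive_comp _ (dF x Ux) dw').
have nU : \forall y \near x, U y by exact: open_nbhs_nbhs.
rewrite -(near_eq_derive _ FE).
(* In the standard basis the moving direction becomes a family of scalar coefficients, to which the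
   product rule for [*:] applies. *)
pose e j : 'rV[R]_m := delta_mx ord0 j.
pose S y := \sum_j w y ord0 j *: 'D_(e j) F y.
have SE : \forall y \near x, S y = 'D_(w y) F y.
  by apply: filterS nU => y Uy; rewrite (derive_delta (w y) (dF y Uy)).
rewrite -(near_eq_derive _ SE).
have wE : \forall y \near x, \sum_j w x ord0 j *: 'D_(e j) F y = 'D_(w x) F y.
  by apply: filterS nU => y Uy; rewrite (derive_delta (w x) (dF y Uy)).
rewrite -(near_eq_derive _ wE).
have dFe j : is_derive x u ('D_(e j) F) ('D_u ('D_(e j) F) x).
  by apply: derivableP; apply: diff_derivable; exact: (d2F _).1.
have dS : is_derive x u S (\sum_j
    (w x ord0 j *: 'D_u ('D_(e j) F) x + 'D_u w x ord0 j *: 'D_(e j) F x)).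
  rewrite (_ : S = \sum_j (fun y => w y ord0 j *: 'D_(e j) F y)); last first.
    by apply/funext => y; rewrite fct_sumE.
  apply: is_derive_sum => j; apply: is_derive_scale => //.
  exact: is_derive_coord.
have dE : is_derive x u (fun y => \sum_j w x ord0 j *: 'D_(e j) F y)
    (\sum_j w x ord0 j *: 'D_u ('D_(e j) F) x).
  rewrite (_ : (fun y => _) = \sum_j (w x ord0 j *: 'D_(e j) F)); last first.
    by apply/funext => y; rewrite fct_sumE.
  exact: is_derive_sum.
by rewrite !derive_val big_split/= addrC (derive_delta ('D_u w x) (dF x Ux)).
Qed.

(** Two instances of [derive_pushforward] are subtracted; their terms in the second derivative of
    [F] coincide by symmetry and cancel. *)
Lemma vector_field_bracket_pushforward {m} (F : 'rV[R]_m -> 'rV[R]_m) U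
    (v w v' w' : 'rV[R]_m -> 'rV[R]_m) x :
  open U -> Ck_on 2 U F -> U x ->
  differentiable v x -> differentiable w x ->
  differentiable v' (F x) -> differentiable w' (F x) ->
  (\forall y \near x, 'D_(v y) F y = v' (F y)) ->
  (\forall y \near x, 'D_(w y) F y = w' (F y)) ->
  'D_(vector_field_bracket v w x) F x = vector_field_bracket v' w' (F x).
Proof.
move=> oU C2 Ux dv dw dv' dw' vE wE.
have Ew := derive_pushforward (v x) oU C2 Ux dw dw' wE.
have Ev := derive_pushforward (w x) oU C2 Ux dv dv' vE.
rewrite (derive_comm (v x) (w x) oU C2 Ux) in Ew.
rewrite /vector_field_bracket derive_dirB; last exact: C2.1.
rewrite -(nbhs_singleton vE) -(nbhs_singleton wE) Ew Ev.
move: ('D_('D_(v x) w x) F x) ('D_('D_(w x) v x) F x) ('D_(w x) _ x) => a b c.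
by rewrite opprD addrACA subrr addr0.
Qed.

End Calculus.

(** * Maps on a product with one variable frozen *)

Section Slices.
Context {R : realType} {U V W : normedModType R}.
Implicit Type f : U * V -> W.

Lemma derive_pairr f p v q :
  'D_v (fun q => f (p, q)) q = 'D_((0, v) : U * V) f (p, q).
Proof.
rewrite /derive.
congr (lim ((_ : R -> W) @ 0^')); apply/funext => h /=.
have -> // : h *: ((0, v) : U * V) + (p, q) = (p, h *: v + q).
by congr pair; rewrite /= scaler0 add0r.
Qed.

Lemma derive_pairl f p v q :
  'D_v (fun p => f (p, q)) p = 'D_((v, 0) : U * V) f (p, q).
Proof.
rewrite /derive.
congr (lim ((_ : R -> W) @ 0^')); apply/funext => h /=.
have -> // : h *: ((v, 0) : U * V) + (p, q) = (h *: v + p, q).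
by congr pair; rewrite /= scaler0 add0r.
Qed.

Lemma differentiable_pairr f p q :
  differentiable f (p, q) -> differentiable (fun q => f (p, q)) q.
Proof.
move=> df; apply: (@differentiable_comp _ _ _ _ (fun q => (p, q)) f) => //.
Qed.

Lemma differentiable_pairl f p q :
  differentiable f (p, q) -> differentiable (fun p => f (p, q)) p.
Proof.
move=> df; apply: (@differentiable_comp _ _ _ _ (fun p => (p, q)) f) => //.
Qed.

(** A directional derivative of a slice is again a slice, of the derivative along [(0, v)]; hence
    the induction on [k]. *)
Lemma Ck_on_pairr k S f p :
  Ck_on k S f -> Ck_on k [set q | S (p, q)] (fun q => f (p, q)).
Proof.
elim: k f => [|k IH] f /= => [fc q Sq|[df dkf]].
  apply: (@continuous_comp _ _ _ (fun q => (p, q)) f); last exact: fc.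
  apply: cvg_pair => //; exact: cvg_cst.
split=> [q Sq|v]; first by apply: differentiable_pairr; exact: df.
rewrite (funext (derive_pairr f p v)); exact: (IH ('D_((0, v) : U * V) f)).

Qed.

Lemma Ck_on_pairl k S f q :
  Ck_on k S f -> Ck_on k [set p | S (p, q)] (fun p => f (p, q)).
Proof.
elim: k f => [|k IH] f /= => [fc p Sp|[df dkf]].
  apply: (@continuous_comp _ _ _ (fun p => (p, q)) f); last exact: fc.
  apply: cvg_pair => //; exact: cvg_cst.
split=> [p Sp|v]; first by apply: differentiable_pairl; exact: df.
rewrite (funext (fun p => derive_pairl f p v q)); exact: (IH ('D_((v, 0) : U * V) f)).
Qed.

End Slices.

Lemma groupmorph1 {G : groupType} (f : G -> G) :
  {morph f : x y / (x * y)%g} -> f 1%g = 1%g.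
Proof. by move=> fM; apply: (mulgI (f 1%g)); rewrite -fM !mulg1. Qed.

Lemma groupmorphV {G : groupType} (f : G -> G) x :
  {morph f : x y / (x * y)%g} -> f x^-1%g = (f x)^-1%g.
Proof.
by move=> fM; apply: (mulgI (f x)); rewrite -fM !mulgV groupmorph1.
Qed.

(** * Charts of a Lie group *)

Section LieGroups.
Context {R : realType} {n : nat} {G : lieGroupType R n}.
Implicit Types (f h : G -> G) (x y g : G).

Local Notation phi x := (cmap (chart_at (x : G))).
Local Notation psi x := (cinv (chart_at (x : G))).

Lemma phiK x y : cdom (chart_at x) y -> psi x (phi x y) = y.
Proof. by have [_ _ [K _] _ _] := chart_atP x; move=> xy; apply: K; rewrite inE. Qed.

Lemma psiK x p : ccod (chart_at x) p -> phi x (psi x p) = p.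
Proof. by have [_ _ [_ K] _ _] := chart_atP x; move=> xp; apply: K; rewrite inE. Qed.

Lemma psi_cdom x p : ccod (chart_at x) p -> cdom (chart_at x) (psi x p).
Proof. by have [_ [_ +] _ _ _] := chart_atP x; apply. Qed.

Lemma phi_ccod x y : cdom (chart_at x) y -> ccod (chart_at x) (phi x y).
Proof. by have [_ [+ _] _ _ _] := chart_atP x; apply. Qed.

Lemma psi_continuous x p : ccod (chart_at x) p -> {for p, continuous (psi x)}.
Proof. by have [_ _ _ _ +] := chart_atP x; apply. Qed.

Lemma near_cdom x y : cdom (chart_at x) y -> \forall z \near y, cdom (chart_at x) z.
Proof. by have [[? _] _ _ _ _] := chart_atP x => xy; exact: open_nbhs_nbhs. Qed.

Lemma near_ccod x p : ccod (chart_at x) p -> \forall q \near p, ccod (chart_at x) q.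
Proof. by have [[_ ?] _ _ _ _] := chart_atP x => xp; exact: open_nbhs_nbhs. Qed.

(** A first-order weakening of [smooth_map]: it is closed under composition by the plain chain rule,
    and it is enough wherever only a differential is taken. *)
Definition differentiable_map f :=
  continuous f /\ forall x y p, ccod (chart_at x) p ->
    cdom (chart_at y) (f (psi x p)) -> differentiable (phi y \o f \o psi x) p.

Lemma smooth_differentiable_map f :
  smooth_map (@chart_at R n G) (@chart_at R n G) f -> differentiable_map f.
Proof.
by move=> [fc fs]; split=> // x y p xp yp; apply: (fs x y 1%N).1.
Qed.

Lemma near_cdom_psi f x y p : continuous f -> ccod (chart_at x) p ->
  cdom (chart_at y) (f (psi x p)) ->
  \forall q \near p, cdom (chart_at y) (f (psi x q)).
Proof.
move=> fc xp yp.
have : {for p, continuous (f \o psi x)}.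
  by apply: continuous_comp; [exact: psi_continuous|exact: fc].
by apply; exact: near_cdom.
Qed.

Lemma near_chart_comp f h x y z p : continuous h -> ccod (chart_at x) p ->
  cdom (chart_at y) (h (psi x p)) ->
  \forall q \near p, ((phi z \o f \o psi y) \o (phi y \o h \o psi x)) q =
    (phi z \o (f \o h) \o psi x) q.
Proof.
move=> hc xp yp; have := near_cdom_psi hc xp yp.
by apply: filterS => q yq /=; rewrite phiK.
Qed.

Lemma differentiable_map_comp f h :
  differentiable_map f -> differentiable_map h -> differentiable_map (f \o h).
Proof.
move=> [fc df] [hc dh]; split=> [x|x z p xp zp].
  by apply: continuous_comp; [exact: hc|exact: fc].
have yp := mem_chart_at (h (psi x p)); set y := h (psi x p) in yp.
apply: near_eq_differentiable (near_chart_comp f z hc xp yp) _.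
apply: differentiable_comp; first exact: dh.
by apply: df => /=; [exact: phi_ccod|rewrite phiK].
Qed.

Lemma smooth_mull g :
  smooth_map (@chart_at R n G) (@chart_at R n G) (fun x => g * x)%g.
Proof.
have [mc ms] := @smooth_mulg R n G; split=> [x|x y k].
  have : {for x, continuous ((fun x : G * G => x.1 * x.2)%g \o (fun x => (g, x)))}.
    apply: continuous_comp; last exact: mc.
    by apply: cvg_pair => //; exact: cvg_cst.
  by [].
have := Ck_on_pairr (phi g g) (ms (g, x) y k).
rewrite /comp/= phiK; last exact: mem_chart_at.
congr (Ck_on _ _ _); apply/seteqP; split=> p /=.
  by move=> [[_ ?] ?].
move=> [? ?]; split => //; split => //; apply: phi_ccod; exact: mem_chart_at.
Qed.

Lemma smooth_mulr g :
  smooth_map (@chart_at R n G) (@chart_at R n G) (fun x => x * g)%g.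
Proof.
have [mc ms] := @smooth_mulg R n G; split=> [x|x y k].
  have : {for x, continuous ((fun x : G * G => x.1 * x.2)%g \o (fun x => (x, g)))}.
    apply: continuous_comp; last exact: mc.
    by apply: cvg_pair => //; exact: cvg_cst.
  by [].
have := Ck_on_pairl (phi g g) (ms (x, g) y k).
rewrite /comp/= phiK; last exact: mem_chart_at.
congr (Ck_on _ _ _); apply/seteqP; split=> p /=.
  by move=> [[? _] ?].
move=> [? ?]; split => //; split => //; apply: phi_ccod; exact: mem_chart_at.
Qed.

Lemma differentiable_conj g : differentiable_map (conjugation_action g).
Proof.
apply: (@differentiable_map_comp (fun x => x * g^-1)%g (fun x => g * x)%g);
  apply: smooth_differentiable_map; [exact: smooth_mulr|exact: smooth_mull].
Qed.

Local Notation o := (@origin R n G).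

Lemma origin_ccod : ccod (chart_at (1%g : G)) o.
Proof. by apply: phi_ccod; exact: mem_chart_at. Qed.

Lemma psi_origin : psi 1%g o = 1%g.
Proof. by apply: phiK; exact: mem_chart_at. Qed.

Lemma differentiable1 f : differentiable_map f -> f 1%g = 1%g ->
  differentiable (phi 1%g \o f \o psi 1%g) o.
Proof.
move=> [fc df] f1; apply: df; first exact: origin_ccod.
by rewrite psi_origin f1; exact: mem_chart_at.
Qed.

Lemma differential1E f X : differentiable_map f -> f 1%g = 1%g ->
  differential1 f X = 'D_X (phi 1%g \o f \o psi 1%g) o.
Proof. by move=> df f1; rewrite deriveE//; exact: differentiable1. Qed.

Lemma differential1_comp f h X :
  differentiable_map f -> f 1%g = 1%g -> differentiable_map h -> h 1%g = 1%g ->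
  differential1 (f \o h) X = differential1 f (differential1 h X).
Proof.
move=> df f1 dh h1.
have fh1 : (f \o h) 1%g = 1%g by rewrite /= h1.
rewrite (differential1E X (differentiable_map_comp df dh) fh1).
rewrite (differential1E _ df f1) (differential1E X dh h1).
have h1c : cdom (chart_at (1%g : G)) (h (psi 1%g o)).
  by rewrite psi_origin h1; exact: mem_chart_at.
have E := near_chart_comp f 1%g dh.1 origin_ccod h1c.
rewrite -(near_eq_derive X E).
have hoE : (phi 1%g \o h \o psi 1%g) o = o by rewrite /= psi_origin h1.
have dh' := differentiable1 dh h1.
have df' := differentiable1 df f1; rewrite -hoE in df'.
by rewrite (derive_comp X dh' df') hoE.
Qed.

Lemma differential1_id X : differential1 (id : G -> G) X = X.
Proof.
have I : \forall p \near o, id p = (phi 1%g \o (id : G -> G) \o psi 1%g) p.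
  have := near_ccod origin_ccod; apply: filterS => p cp.
  by rewrite /= psiK.
rewrite differential1E//; first by rewrite -(near_eq_derive _ I) derive_id.
by apply: smooth_differentiable_map; exact: chart_at_compatible.
Qed.

End LieGroups.

(** * The Lie bracket and the adjoint action *)

Section Bracket.
Context {R : realType} {n : nat} {G : lieGroupType R n}.
Implicit Types (f h : G -> G) (x y g : G) (X Y : 'rV[R]_n).

Local Notation phi x := (cmap (chart_at (x : G))).
Local Notation psi x := (cinv (chart_at (x : G))).
Local Notation o := (@origin R n G).
Local Notation V := 'rV[R]_n.

(** The left factor and the product share the chart at [x], while the right factor stays near 1.
    Thus [(p, o)] is in the domain for every [p] of the chart, and differentiation in the second
    slot gives the left-invariant fields. *)
Definition mul_chart x (p : V * V) : V := phi x (psi x p.1 * psi 1%g p.2)%g.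

Definition mul_dom x : set (V * V) :=
  [set p | (ccod (chart_at x) p.1 /\ ccod (chart_at (1%g : G)) p.2) /\
    cdom (chart_at x) (psi x p.1 * psi 1%g p.2)%g].

Lemma smooth_mul_chart x : smooth_on (mul_dom x) (mul_chart x).
Proof. by have [_ /(_ (x, 1%g) x)] := @smooth_mulg R n G. Qed.

Lemma mul_dom1 x p : ccod (chart_at x) p -> mul_dom x (p, o).
Proof.
move=> xp; split; first by split => //; exact: origin_ccod.
by rewrite /= psi_origin mulg1; exact: psi_cdom.
Qed.

Lemma mul_chart1 x p : ccod (chart_at x) p -> mul_chart x (p, o) = p.
Proof. by move=> xp; rewrite /mul_chart/= psi_origin mulg1 psiK. Qed.

Lemma mul_dom_1 p : ccod (chart_at (1%g : G)) p -> mul_dom 1%g (o, p).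
Proof.
move=> xp; split; first by split => //; exact: origin_ccod.
by rewrite /= psi_origin mul1g; exact: psi_cdom.
Qed.

Lemma mul_chart_1 p : ccod (chart_at (1%g : G)) p -> mul_chart 1%g (o, p) = p.
Proof. by move=> xp; rewrite /mul_chart/= psi_origin mul1g psiK. Qed.

Lemma open_mul_dom1 : open (mul_dom 1%g).
Proof.
rewrite openE => -[p q] [[/= p1 q1] pq1].
have c : {for (p, q), continuous (fun r : V * V => psi 1%g r.1 * psi 1%g r.2)%g}.
  have : {for (p, q), continuous ((fun a : G * G => a.1 * a.2)%g \o
      (fun r : V * V => (psi 1%g r.1, psi 1%g r.2)))}.
    apply: continuous_comp; last by have [mc _] := @smooth_mulg R n G; exact: mc.
    apply: cvg_pair.
      apply: (@continuous_comp _ _ _ fst (psi 1%g)); first exact: cvg_fst.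
      exact: psi_continuous.
    apply: (@continuous_comp _ _ _ snd (psi 1%g)); first exact: cvg_snd.
    exact: psi_continuous.
  by [].
apply: filterI; last by apply: c; exact: near_cdom.
apply: filterI.
  have : fst @ (p, q) --> p by exact: cvg_fst.
  by apply; exact: near_ccod.
have : snd @ (p, q) --> q by exact: cvg_snd.
by apply; exact: near_ccod.
Qed.

(* The left-invariant field of X read in the chart at x; [left_field 1] is
   convertible to [left_invariant_field]. *)
Definition left_field x X p : V := 'D_X (fun q => mul_chart x (p, q)) o.

Lemma left_fieldE x X :
  left_field x X = fun p => 'D_((0, X) : V * V) (mul_chart x) (p, o).
Proof. by apply/funext => p; rewrite /left_field derive_pairr. Qed.

Lemma left_field_differentiable x X p : ccod (chart_at x) p ->
  differentiable (left_field x X) p.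
Proof.
move=> xp; rewrite left_fieldE.
apply: (differentiable_pairl (f := 'D_((0, X) : V * V) (mul_chart x))).
by apply: ((smooth_mul_chart x 2%N).2 _).1; exact: mul_dom1.
Qed.

Lemma mul_chart_differentiable x p : ccod (chart_at x) p ->
  differentiable (mul_chart x) (p, o).
Proof. by move=> xp; apply: (smooth_mul_chart x 1%N).1; exact: mul_dom1. Qed.

Lemma left_field_origin X : left_field 1%g X o = X.
Proof.
have E : \forall p \near o, id p = mul_chart 1%g (o, p).
  have := near_ccod (@origin_ccod R n G); apply: filterS => p cp.
  by rewrite mul_chart_1.
by rewrite /left_field -(near_eq_derive X E) derive_id.
Qed.

(* Applied to (F, C) = (left multiplication by g, id) and then to (right
   multiplication by g^-1, conjugation by g): conjugation is split in this way
   so that no C^2 chain rule is needed. *)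
Lemma left_field_pushforward (F C : G -> G) x y p X :
  smooth_map (@chart_at R n G) (@chart_at R n G) F ->
  differentiable_map C -> C 1%g = 1%g ->
  (forall a b, F (a * b)%g = (F a * C b)%g) ->
  ccod (chart_at x) p -> cdom (chart_at y) (F (psi x p)) ->
  'D_(left_field x X p) (phi y \o F \o psi x) p =
    left_field y (differential1 C X) ((phi y \o F \o psi x) p).
Proof.
move=> sF dC C1 FC xp yp; have [Fc dF] := smooth_differentiable_map sF.
have xp1 : cdom (chart_at x) (psi x p * psi 1%g o)%g by exact: (mul_dom1 xp).2.
have C1c : cdom (chart_at (1%g : G)) (C (psi 1%g o)).
  by rewrite psi_origin C1; exact: mem_chart_at.
have n1 := near_cdom_psi (smooth_mull (psi x p)).1 origin_ccod xp1.
have n2 := near_cdom_psi dC.1 origin_ccod C1c.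
have E : \forall q \near o,
    ((phi y \o F \o psi x) \o (fun q => mul_chart x (p, q))) q =
    ((fun q => mul_chart y ((phi y \o F \o psi x) p, q)) \o
      (phi 1%g \o C \o psi 1%g)) q.
  near=> q; rewrite /= /mul_chart/= !phiK// ?FC//; near: q => //.
have d1 : differentiable (fun q => mul_chart x (p, q)) o.
  by apply: (differentiable_pairr (f := mul_chart x)); exact: mul_chart_differentiable.
have d2 : differentiable (phi y \o F \o psi x) (mul_chart x (p, o)).
  by rewrite mul_chart1//; exact: dF.
have Co : (phi 1%g \o C \o psi 1%g) o = o by rewrite /= psi_origin C1.
have d3 : differentiable (fun q => mul_chart y ((phi y \o F \o psi x) p, q))
    ((phi 1%g \o C \o psi 1%g) o).
  rewrite Co; apply: (differentiable_pairr (f := mul_chart y)).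
  apply: mul_chart_differentiable.
  exact: phi_ccod.
have := near_eq_derive X E.
rewrite (derive_comp X d1 d2) (derive_comp X (differentiable1 dC C1) d3).
by rewrite Co (mul_chart1 xp) (differential1E X dC C1).
Unshelve. all: by end_near. Qed.

(** By [left_field_pushforward], [F] relates each left field at [x] to the one at [y] twisted by the
    differential of [C], and brackets follow related fields. *)
Lemma left_bracket_pushforward (F C : G -> G) x y X Y :
  smooth_map (@chart_at R n G) (@chart_at R n G) F ->
  differentiable_map C -> C 1%g = 1%g ->
  (forall a b, F (a * b)%g = (F a * C b)%g) -> F x = y ->
  'D_(vector_field_bracket (left_field x X) (left_field x Y) (phi x x))
    (phi y \o F \o psi x) (phi x x) =
  vector_field_bracket (left_field y (differential1 C X))
    (left_field y (differential1 C Y)) (phi y y).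
Proof.
move=> sF dC C1 FC Fxy.
pose U : set V := [set p | ccod (chart_at x) p /\ cdom (chart_at y) (F (psi x p))].
have oU : open U.
  rewrite openE => p [xp yp]; apply: filterI; first exact: near_ccod.
  exact: near_cdom_psi sF.1 xp yp.
have xx : cdom (chart_at x) x := mem_chart_at x.
have yy : cdom (chart_at y) y := mem_chart_at y.
have Ux : U (phi x x) by split; [exact: phi_ccod|rewrite phiK// Fxy].
have FE : (phi y \o F \o psi x) (phi x x) = phi y y by rewrite /= phiK// Fxy.
have push Z : \forall p \near phi x x, 'D_(left_field x Z p) (phi y \o F \o psi x) p =
    left_field y (differential1 C Z) ((phi y \o F \o psi x) p).
  have : \forall p \near phi x x, U p by exact: open_nbhs_nbhs.
  by apply: filterS => p [xp yp]; exact: left_field_pushforward.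
have dl Z : differentiable (left_field x Z) (phi x x).
  by apply: left_field_differentiable; exact: phi_ccod.
have dr Z : differentiable (left_field y Z) ((phi y \o F \o psi x) (phi x x)).
  by rewrite FE; apply: left_field_differentiable; exact: phi_ccod.
have := vector_field_bracket_pushforward oU (sF.2 x y 2%N) Ux (dl X) (dl Y)
  (dr _) (dr _) (push X) (push Y).
by rewrite FE.
Qed.

Definition Ad g X := differential1 (conjugation_action g) X.

Lemma conj1 g : conjugation_action g 1%g = 1%g.
Proof. by rewrite /conjugation_action mulg1 mulgV. Qed.

(** Left multiplication by [g] takes the bracket at 1 to the bracket at [g] of the same fields;
    right multiplication by the inverse of [g] brings it back to 1 with [Ad g] applied to both
    arguments. *)
Lemma Ad_bracket g X Y :
  Ad g (lie_bracket G X Y) = lie_bracket G (Ad g X) (Ad g Y).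
Proof.
have did : differentiable_map (id : G -> G).
  by apply: smooth_differentiable_map; exact: chart_at_compatible.
have B1 := left_bracket_pushforward X Y (smooth_mull g) did erefl
  (fun a b => mulgA g a b) (mulg1 g).
have B2 := left_bracket_pushforward X Y (smooth_mulr g^-1%g)
  (differentiable_conj g) (conj1 g) _ (mulgV g).
rewrite [LHS](differential1E _ (differentiable_conj g) (conj1 g)).
have gg : cdom (chart_at g) g := mem_chart_at g.
have g1 : cdom (chart_at g) (g * psi 1%g o)%g by rewrite psi_origin mulg1.
have E := near_chart_comp (fun x => x * g^-1)%g 1%g (smooth_mull g).1 origin_ccod g1.
rewrite -(near_eq_derive _ E).
have d1 : differentiable (phi g \o (fun x => g * x)%g \o psi 1%g) o.
  by apply: (smooth_differentiable_map (smooth_mull g)).2 => //; exact: origin_ccod.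
have Fo : (phi g \o (fun x => g * x)%g \o psi 1%g) o = phi g g.
  by rewrite /= psi_origin mulg1.
have d2 : differentiable (phi 1%g \o (fun x => x * g^-1)%g \o psi g)
    ((phi g \o (fun x => g * x)%g \o psi 1%g) o).
  rewrite Fo; apply: (smooth_differentiable_map (smooth_mulr _)).2 => //.
    exact: phi_ccod.
  by rewrite phiK// mulgV; exact: mem_chart_at.
rewrite (derive_comp _ d1 d2) Fo.
move: B1; rewrite !differential1_id => ->.
by rewrite B2// => a b; rewrite /conjugation_action !mulgA mulgVK.
Qed.

(** Left-invariant fields are derivatives of the product in its second slot. The order of
    differentiation is exchanged in the second term so that [X] is the outer direction in both,
    ready to become the velocity of a curve. *)
Lemma lie_bracketE X Y : lie_bracket G X Y =
  'D_((X, 0) : V * V) ('D_((0, Y) : V * V) (mul_chart 1%g)) (o, o) -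
  'D_((0, X) : V * V) ('D_((Y, 0) : V * V) (mul_chart 1%g)) (o, o).
Proof.
rewrite /lie_bracket /vector_field_bracket.
have LE Z : left_invariant_field G Z = left_field 1%g Z by [].
have oD : mul_dom 1%g (o, o) by apply: mul_dom1; exact: origin_ccod.
have E1 := derive_pairl ('D_((0, Y) : V * V) (mul_chart 1%g)) o X o.
have E2 := derive_pairl ('D_((0, X) : V * V) (mul_chart 1%g)) o Y o.
have E3 := derive_comm (Y, 0) (0, X) open_mul_dom1 (smooth_mul_chart 1%g 2%N) oD.
rewrite !LE !left_field_origin !left_fieldE.
exact: (congr2 (fun a b : V => a - b) E1 (etrans E2 E3)).
Qed.

Lemma lie_bracket_linearr X : linear (lie_bracket G X).
Proof.
move=> k Y Z; rewrite !lie_bracketE.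
have oD : mul_dom 1%g (o, o) by apply: mul_dom1; exact: origin_ccod.
have nD : \forall p \near (o, o), mul_dom 1%g p.
  by apply: open_nbhs_nbhs; split => //; exact: open_mul_dom1.
have dm p : mul_dom 1%g p -> differentiable (mul_chart 1%g) p.
  exact: (smooth_mul_chart 1%g 1%N).1.
have d2m v : differentiable ('D_v (mul_chart 1%g)) (o, o).
  by apply: ((smooth_mul_chart 1%g 2%N).2 _).1.
(* [Y] is the inner direction in both terms of [lie_bracketE]; linearity in it holds on a whole
   neighbourhood, so it survives the outer derivative. *)
have D2 (u a b : V * V) :
    'D_u ('D_(k *: a + b) (mul_chart 1%g)) (o, o) =
    k *: 'D_u ('D_a (mul_chart 1%g)) (o, o) + 'D_u ('D_b (mul_chart 1%g)) (o, o).
  have E : \forall p \near (o, o), (k *: 'D_a (mul_chart 1%g) +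
      'D_b (mul_chart 1%g)) p = 'D_(k *: a + b) (mul_chart 1%g) p.
    by apply: filterS nD => p /dm dp; rewrite (derive_is_linear dp).
  have dv v : is_derive (o, o) u ('D_v (mul_chart 1%g))
      ('D_u ('D_v (mul_chart 1%g)) (o, o)).
    by apply: derivableP; apply: diff_derivable; exact: d2m.
  apply: etrans (esym (near_eq_derive u E)) _.
  exact: (@derive_val _ _ _ _ _ _ _ (is_deriveD (is_deriveZ k (dv a)) (dv b))).
have -> : ((0, k *: Y + Z) : V * V) = k *: ((0, Y) : V * V) + (0, Z).
  by congr pair; rewrite /= scaler0 addr0.
have -> : ((k *: Y + Z, 0) : V * V) = k *: ((Y, 0) : V * V) + (Z, 0).
  by congr pair; rewrite /= scaler0 addr0.
have B (a b c d : V) : (k *: a + b) - (k *: c + d) = k *: (a - c) + (b - d).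
  by rewrite scalerBr opprD addrACA.
exact: etrans (congr2 (fun a b : V => a - b) (D2 _ _ _) (D2 _ _ _)) (B _ _ _ _).
Qed.

Lemma lie_bracketC X Y : lie_bracket G X Y = - lie_bracket G Y X.
Proof. by rewrite /lie_bracket /vector_field_bracket opprB. Qed.

(** The identity g b = (g b g^-1) g is differentiated at b = 1 in the direction [Y]: its left side
    gives the left-invariant field of [Y] at [g], its right side the right-invariant field of
    [Ad g Y]. *)
Lemma Ad_id_chart g Y : cdom (chart_at (1%g : G)) g -> Ad g Y = Y ->
  'D_((0, Y) : V * V) (mul_chart 1%g) (phi 1%g g, o) =
  'D_((Y, 0) : V * V) (mul_chart 1%g) (o, phi 1%g g).
Proof.
move=> cg AY; set p := phi 1%g g.
have cp : ccod (chart_at (1%g : G)) p by exact: phi_ccod.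
have c1 : cdom (chart_at (1%g : G)) (conjugation_action g (psi 1%g o)).
  by rewrite psi_origin conj1; exact: mem_chart_at.
have n1 := near_cdom_psi (differentiable_conj g).1 (@origin_ccod R n G) c1.
have E : \forall q \near o, (fun q => mul_chart 1%g (p, q)) q =
    ((fun r => mul_chart 1%g (r, p)) \o (phi 1%g \o conjugation_action g \o psi 1%g)) q.
  apply: filterS n1 => q cq.
  by rewrite /= /mul_chart/= !phiK// /conjugation_action mulgVK.
have Co : (phi 1%g \o conjugation_action g \o psi 1%g) o = o by rewrite /= psi_origin conj1.
have d2 : differentiable (fun r => mul_chart 1%g (r, p))
    ((phi 1%g \o conjugation_action g \o psi 1%g) o).
  rewrite Co; apply: (differentiable_pairl (f := mul_chart 1%g)).
  by apply: (smooth_mul_chart 1%g 1%N).1; exact: mul_dom_1.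
have := near_eq_derive Y E.
rewrite (derive_comp Y (differentiable1 (differentiable_conj g) (conj1 g)) d2).
rewrite -(differential1E _ (differentiable_conj g) (conj1 g)) -/(Ad g Y) AY Co.
by rewrite derive_pairr derive_pairl.
Qed.

Lemma AdM g g' X : Ad (g * g')%g X = Ad g (Ad g' X).
Proof.
rewrite /Ad -(differential1_comp X (differentiable_conj g) (conj1 g)
  (differentiable_conj g') (conj1 g')).
apply: (congr1 (fun f => differential1 f X)); apply/funext => x.
by rewrite /= /conjugation_action invgM !mulgA.
Qed.

Lemma Ad1 X : Ad 1%g X = X.
Proof.
rewrite /Ad (_ : conjugation_action _ = id) ?differential1_id//.
by apply/funext => x; rewrite /conjugation_action invg1 mulg1 mul1g.
Qed.

Lemma AdK g : cancel (Ad g) (Ad g^-1%g).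
Proof. by move=> X; rewrite -AdM mulVg Ad1. Qed.

Lemma AdVK g : cancel (Ad g^-1%g) (Ad g).
Proof. by move=> X; rewrite -AdM mulgV Ad1. Qed.

Lemma Ad_linear g : linear (Ad g).
Proof.
move=> k X Y; rewrite /Ad !(differential1E _ (differentiable_conj g) (conj1 g)).
rewrite (derive_is_linear _ k X Y) //.
exact: differentiable1 (differentiable_conj g) (conj1 g).
Qed.

Lemma Ad_automorphism f g X : differentiable_map f ->
  {morph f : x y / (x * y)%g} ->
  differential1 f (Ad g X) = Ad (f g) (differential1 f X).
Proof.
move=> df fM.
have f1 := groupmorph1 fM.
rewrite /Ad -(differential1_comp X df f1 (differentiable_conj g) (conj1 g)).
rewrite -(differential1_comp X (differentiable_conj (f g)) (conj1 (f g)) df f1).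
apply: (congr1 (fun f => differential1 f X)); apply/funext => x.
by rewrite /= /conjugation_action !fM groupmorphV.
Qed.

End Bracket.

(** * One-parameter subgroups *)

Section RealVariable.
Context {R : realType}.

Lemma is_derive_shift0 {W : normedModType R} (k : R -> W) (t : R) d :
  is_derive (0 : R) 1 (fun s => k (s + t)) d -> is_derive t 1 k d.
Proof.
have E : (fun h : R => h^-1 *: (k (h *: (1 : R^o) + 0 + t) - k (0 + t))) =
    (fun h : R => h^-1 *: (k (h *: (1 : R^o) + t) - k t)).
  by apply/funext => h; rewrite addr0 add0r.
by move=> [kd <-]; split; move: kd; rewrite /derivable /derive/= E.
Qed.

Lemma is_derive_curve_comp {V W : normedModType R} (f : R -> V) (g : V -> W)
    (t : R) d : is_derive t 1 f d -> differentiable g (f t) ->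
  is_derive t 1 (g \o f) ('D_d g (f t)).
Proof.
move=> [/derivable1_diffP df <-] dg; split.
  by apply/derivable1_diffP; exact: differentiable_comp.
exact: derive_comp.
Qed.

Lemma is_derive_pair {V W : normedModType R} (f : R -> V) (g : R -> W)
    (t : R) d e : is_derive t 1 f d -> is_derive t 1 g e ->
  is_derive t 1 (fun s => (f s, g s)) (d, e).
Proof.
move=> [/derivable1_diffP df <-] [/derivable1_diffP dg <-].
have dfg : differentiable (fun s => (f s, g s)) t by exact: differentiable_pair.
split; first exact/derivable1_diffP.
by rewrite (deriveE _ dfg) diff_pair// (deriveE _ df) (deriveE _ dg).
Qed.

Lemma constant_of_derive0 {m} (k : R -> 'rV[R]_m) (r : R) :
  (forall t : R, `|t| < r -> is_derive t 1 k 0) -> forall t : R, `|t| < r -> k t = k 0.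
Proof.
move=> dk t tr; apply/rowP => j.
have dkj (s : R) : `|s| < r -> is_derive s 1 (fun s => k s ord0 j) 0.
  move=> /dk[ks k0]; split; first by move/derivable_mxP : ks => /(_ ord0 j).
  by move: k0; rewrite derive_mx// => /rowP/(_ j); rewrite !mxE.
have [t0|t0] := lerP 0 t.
- have d (s : R) : s \in `[0, t] -> is_derive s 1 (fun s => k s ord0 j) (cst 0 s).
    rewrite in_itv/= => /andP[s0 st]; apply: dkj.
    by rewrite ger0_norm// (le_lt_trans st)// -(ger0_norm t0).
  have c : {within `[0, t], continuous (fun s => k s ord0 j)}.
    by apply: derivable_within_continuous => s /d; case.
  have d' (s : R) : s \in `]0, t[ -> is_derive s 1 (fun s => k s ord0 j) (cst 0 s).
    by move=> /subset_itv_oo_cc; exact: d.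
  have [s _] := MVT_segment t0 d' c.
  by rewrite mul0r => /eqP; rewrite subr_eq0 => /eqP.
- have d (s : R) : s \in `[t, 0] -> is_derive s 1 (fun s => k s ord0 j) (cst 0 s).
    rewrite in_itv/= => /andP[ts s0]; apply: dkj.
    by rewrite ler0_norm// (le_lt_trans _ tr)// ltr0_norm// lerN2.
  have c : {within `[t, 0], continuous (fun s => k s ord0 j)}.
    by apply: derivable_within_continuous => s /d; case.
  have d' (s : R) : s \in `]t, 0[ -> is_derive s 1 (fun s => k s ord0 j) (cst 0 s).
    by move=> /subset_itv_oo_cc; exact: d.
  have [s _] := MVT_segment (ltW t0) d' c.
  by rewrite mul0r => /eqP; rewrite subr_eq0 => /eqP.
Qed.

(** Each zero makes a difference quotient vanish, and these quotients tend to [d]. Zeros that merely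
    accumulate at 0 suffice, such as dyadic fractions of a period. *)
Lemma derive_eq0_of_zeros {W : normedModType R} (k : R -> W) (d : W) :
  is_derive (0 : R) 1 k d -> k 0 = 0 ->
  (forall e, 0 < e -> exists t, [/\ t != 0, `|t| < e & k t = 0]) -> d = 0.
Proof.
move=> [kd <-] k0 zs; apply/eqP; apply: contraT => dn0.
have /cvgrPdist_lt/(_ `|'D_1 k 0|) : (fun h => h^-1 *: (k (h *: (1 : R^o) + 0) - k 0))
    @ 0^' --> 'D_1 k 0 by exact: kd.
rewrite normr_gt0 => /(_ dn0) /nbhs_ballP[e /= e0 eP].
have [t [t0 te kt]] := zs e e0.
have tb : ball (0 : R) e t by rewrite /ball/= sub0r normrN.
have := eP t tb t0.
by rewrite /= addr0 [t *: 1]mulr1 kt k0 subrr scaler0 subr0 ltxx.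
Qed.

Lemma small_dyadic (t r : R) : 0 < r -> exists k, `|t / 2 ^+ k| < r.
Proof.
move=> r0; have [k tk] : exists k : nat, `|t| / r < k%:R.
  by exists (Num.bound (`|t| / r)); rewrite archi_boundP// divr_ge0// ltW.
exists k; rewrite normrM normfV (@ger0_norm _ (2 ^+ k)) ?exprn_ge0//.
rewrite ltr_pdivrMr ?exprn_gt0// mulrC -ltr_pdivrMr//.
by rewrite (lt_le_trans tk)// -natrX ler_nat ltnW// ltn_expl.
Qed.

End RealVariable.

Section OneParameter.
Context {R : realType} {n : nat} {G : lieGroupType R n}.
Implicit Types (f : G -> G) (c : R -> G) (X Y : 'rV[R]_n).

Local Notation phi x := (cmap (chart_at (x : G))).
Local Notation psi x := (cinv (chart_at (x : G))).
Local Notation o := (@origin R n G).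
Local Notation V := 'rV[R]_n.

(* Unlike [one_parameter_subgroup], this only asks for regularity at 0. *)
Definition is_psg c X :=
  [/\ {morph c : s t / s + t >-> (s * t)%g}, {for 0, continuous c} &
      is_derive (0 : R) 1 (phi 1%g \o c) X].

Lemma psg0 c X : is_psg c X -> c 0 = 1%g.
Proof. by move=> [cD _ _]; apply: (mulgI (c 0)); rewrite -cD addr0 mulg1. Qed.

Lemma psgNE c X t : is_psg c X -> c (- t) = (c t)^-1%g.
Proof.
move=> cX; have [cD _ _] := cX; apply: (mulgI (c t)).
by rewrite -cD subrr mulgV (psg0 cX).
Qed.

Lemma one_parameter_subgroup_psg c X : one_parameter_subgroup c X -> is_psg c X.
Proof.
move=> [[cc cs] cD cX]; split => //; first exact: cc.
have c0 : c 0 = 1%g by apply: (mulgI (c 0)); rewrite -cD addr0 mulg1.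
rewrite -cX; apply: derivableP; apply: diff_derivable.
by apply: (cs tt 1%g 1%N).1; split => //=; rewrite c0; exact: mem_chart_at.
Qed.

Lemma psgN c X : is_psg c X -> is_psg (fun t => c (- t)) (- X).
Proof.
move=> cX; have [cD cc dc] := cX; split.
- by move=> s t; rewrite opprD cD.
- apply: (@continuous_comp _ _ _ (-%R) c); first exact: oppr_continuous.
  by rewrite oppr0.
have d1 : is_derive (0 : R) 1 (-%R : R -> R) (-1) by exact: is_deriveNid.
have d2 : differentiable (phi 1%g \o c) (- 0).
  by rewrite oppr0; apply/derivable1_diffP; case: dc.
have := is_derive_curve_comp d1 d2.
by rewrite oppr0 in d2 *; rewrite (deriveE _ d2) linearN -(deriveE _ d2); case: dc => _ ->.
Qed.

Lemma psg_map f c X : differentiable_map f -> {morph f : x y / (x * y)%g} ->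
  is_psg c X -> is_psg (f \o c) (differential1 f X).
Proof.
move=> df fM cX; have [cD cc dc] := cX; have c0 := psg0 cX.
have f1 := groupmorph1 fM.
split.
- by move=> s t; rewrite /= cD fM.
- by apply: continuous_comp => //; exact: df.1.
have co : (phi 1%g \o c) 0 = o by rewrite /= c0.
have d2 : differentiable (phi 1%g \o f \o psi 1%g) ((phi 1%g \o c) 0).
  by rewrite co; exact: differentiable1.
have E : \forall s \near (0 : R), ((phi 1%g \o f \o psi 1%g) \o (phi 1%g \o c)) s =
    (phi 1%g \o (f \o c)) s.
  have : \forall s \near (0 : R), cdom (chart_at (1%g : G)) (c s).
    by apply: cc; apply: near_cdom; rewrite c0; exact: mem_chart_at.
  by apply: filterS => s cs; rewrite /= phiK.
apply: near_eq_is_derive E _.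
by have := is_derive_curve_comp dc d2; rewrite co -differential1E.
Qed.

(** With one factor equal to 1 the product is the identity in the other, and a differential is the
    sum of its two partial ones. *)
Lemma derive_mul_chart_origin (u : V * V) : 'D_u (mul_chart (1%g : G)) (o, o) = u.1 + u.2.
Proof.
have d := mul_chart_differentiable (@origin_ccod R n G).
have Er : 'D_((0, u.2) : V * V) (mul_chart (1%g : G)) (o, o) = u.2.
  by rewrite -(derive_pairr (mul_chart (1%g : G))); exact: left_field_origin.
have El : 'D_((u.1, 0) : V * V) (mul_chart (1%g : G)) (o, o) = u.1.
  have E : \forall p \near o, id p = mul_chart (1%g : G) (p, o).
    have := near_ccod (@origin_ccod R n G); apply: filterS => p cp.
    by rewrite mul_chart1.
  rewrite -(derive_pairl (mul_chart (1%g : G))).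
  by apply: etrans (esym (near_eq_derive u.1 E)) _; exact: derive_id.
have uE : 1 *: ((u.1, 0) : V * V) + (0, u.2) = u.
  by rewrite scale1r; case: (u) => a b; congr pair; rewrite /= ?addr0 ?add0r.
have := derive_is_linear d 1 ((u.1, 0) : V * V) (0, u.2).
by rewrite uE El Er scale1r.
Qed.

(* c(-t) c'(t) is constant: as c(-t-s) c'(t+s) = c(-t) (c(-s) c'(s)) c'(t), its
   derivative at t is the image of -X + X = 0. *)
Lemma psg_unique_near c c' X : is_psg c X -> is_psg c' X ->
  exists2 r : R, 0 < r & forall t, `|t| < r -> c t = c' t.
Proof.
move=> cX cX'; have [cD cc dc] := cX; have [cD' cc' dc'] := cX'.
have c0 := psg0 cX; have c0' := psg0 cX'.
have cN := psgN cX.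
pose f t := (c (- t) * c' t)%g.
have f0 : f 0 = 1%g by rewrite /f oppr0 c0 c0' mulg1.
pose gamma s := mul_chart (1%g : G) (phi 1%g (c (- s)), phi 1%g (c' s)).
have dgamma : is_derive (0 : R) 1 gamma 0.
  have d1 : is_derive (0 : R) 1
      (fun s => (phi 1%g (c (- s)), phi 1%g (c' s)) : V * V) (- X, X).
    by apply: is_derive_pair => //; case: cN.
  have P0 : (phi 1%g (c (- 0)), phi 1%g (c' 0)) = (o, o) by rewrite oppr0 c0 c0'.
  have d2 : differentiable (mul_chart (1%g : G)) (phi 1%g (c (- 0)), phi 1%g (c' 0)).
    by rewrite P0; apply: mul_chart_differentiable; exact: origin_ccod.
  have := is_derive_curve_comp d1 d2.
  by rewrite P0 derive_mul_chart_origin /= addNr.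
have nf : \forall t \near (0 : R), cdom (chart_at (1%g : G)) (f t).
  have : {for (0 : R), continuous ((fun a : G * G => a.1 * a.2)%g \o
      (fun s => (c (- s), c' s)))}.
    apply: continuous_comp; last by have [mc _] := @smooth_mulg R n G; exact: mc.
    by apply: cvg_pair => //; have [] := cN.
  by apply; apply: near_cdom => /=; rewrite oppr0 c0 c0' mulg1; exact: mem_chart_at.
have df t : cdom (chart_at (1%g : G)) (f t) -> is_derive t 1 (phi 1%g \o f) 0.
  move=> ft; apply: is_derive_shift0.
  pose F g := (c (- t) * g * c' t)%g.
  have dF : differentiable_map F.
    apply: (@differentiable_map_comp _ _ _ (fun x => x * c' t)%g (fun x => c (- t) * x)%g);
      apply: smooth_differentiable_map; [exact: smooth_mulr|exact: smooth_mull].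
  have g0 : gamma 0 = o.
    rewrite /gamma oppr0 c0 c0'; apply: mul_chart1; exact: origin_ccod.
  have d2 : differentiable (phi 1%g \o F \o psi 1%g) (gamma 0).
    rewrite g0; apply: dF.2; first exact: origin_ccod.
    by rewrite psi_origin /F mulg1.
  have nN : \forall s \near (0 : R), cdom (chart_at (1%g : G)) (c (- s)).
    by have [_ + _] := cN; apply; apply: near_cdom; rewrite oppr0 c0; exact: mem_chart_at.
  have nP : \forall s \near (0 : R), cdom (chart_at (1%g : G)) (c' s).
    by apply: cc'; apply: near_cdom; rewrite c0'; exact: mem_chart_at.
  have E : \forall s \near (0 : R), ((phi 1%g \o F \o psi 1%g) \o gamma) s =
      (phi 1%g \o f) (s + t).
    near=> s; rewrite /= /gamma /mul_chart/=.
    rewrite (phiK (near nN s _))// (phiK (near nP s _))// (phiK (near nf s _))//.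
    by rewrite /F /f opprD [- s - t]addrC cD cD' !mulgA.
  apply: near_eq_is_derive E _.
  by have := is_derive_curve_comp dgamma d2; rewrite derive0.
have /nbhs_normP[r /= r0 rP] := nf.
have {}rP t : `|t| < r -> cdom (chart_at (1%g : G)) (f t).
  by move=> tr; apply: rP; rewrite /= sub0r normrN.
exists r => // t tr.
have := constant_of_derive0 (fun t tr => df t (rP t tr)) tr.
rewrite /= f0 => ft.
have : f t = 1%g.
  by rewrite -(phiK (rP t tr)) ft psi_origin.
rewrite /f (psgNE t cX) => ft1.
by apply: (mulgI (c t)^-1%g); rewrite ft1 mulVg.
Unshelve. all: by end_near. Qed.

(** Equality near 0 spreads by doubling: c(t) is the square of c(t / 2), and some [t / 2 ^+ k] is
    small. *)
Lemma psg_unique c c' X : is_psg c X -> is_psg c' X -> c =1 c'.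
Proof.
move=> cX cX' t; have [r r0 rP] := psg_unique_near cX cX'.
have [k] := small_dyadic t r0.
have [cD _ _] := cX; have [cD' _ _] := cX'.
elim: k t => [|k IH] t; first by rewrite expr0 divr1; exact: rP.
rewrite exprS invfM mulrA => /IH E.
by rewrite (splitr t) cD cD' E.
Qed.

Lemma psg_cst : is_psg (fun=> 1%g) 0.
Proof.
split; first by move=> s t; rewrite mulg1.
- exact: cvg_cst.
- exact: is_derive_cst.
Qed.

(* Existence of one-parameter subgroups is not needed: the default value of
   [xget] in [lie_exp] is 1. *)
Lemma lie_expP X : lie_exp G X = 1%g \/
  exists2 c, is_psg c X & lie_exp G X = c 1.
Proof.
rewrite /lie_exp; case: xgetP => [g _ [c cX ->]|_]; last by left.
by right; exists c => //; exact: one_parameter_subgroup_psg.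
Qed.

Lemma lie_exp0 : lie_exp G 0 = 1%g.
Proof. by have [//|[c cX ->]] := lie_expP 0; rewrite (psg_unique cX psg_cst). Qed.

(** The subgroups [f \o c] and t |-> c(-t) have the same velocity [- X], hence coincide; if
    [lie_exp] takes its default value, 1 is its own inverse. *)
Lemma lie_exp_inv f X : differentiable_map f -> {morph f : x y / (x * y)%g} ->
  differential1 f X = - X -> f (lie_exp G X) = (lie_exp G X)^-1%g.
Proof.
move=> df fM fX; have [->|[c cX ->]] := lie_expP X.
  by rewrite invg1 groupmorph1.
have := psg_map df fM cX; rewrite fX => /psg_unique/(_ (psgN cX) 1) /= ->.
exact: psgNE cX.
Qed.

End OneParameter.

(** * The Killing form and periodic one-parameter subgroups *)

Section Lin1.
Context {R : comNzRingType} {n : nat}.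
Implicit Types f h : 'rV[R]_n -> 'rV[R]_n.

Lemma mul_rV_lin1_linear f u : linear f -> u *m lin1_mx f = f u.
Proof.
move=> lf; pose L := GRing.isLinear.Build _ _ _ _ _ lf.
pose g : {linear 'rV[R]_n -> 'rV[R]_n} := HB.pack f L.
exact: (mul_rV_lin1 g).
Qed.

Lemma lin1_mx_comp f h : linear f -> lin1_mx (f \o h) = lin1_mx h *m lin1_mx f.
Proof.
move=> lf; apply/row_matrixP => i.
rewrite row_mul mul_rV_lin1_linear//; apply/rowP => j; rewrite !mxE.
by congr (f _ _ j); apply/rowP => k; rewrite !mxE.
Qed.

End Lin1.

(** The operator ad(A X) is the conjugate of ad(X) by [A]; cyclicity of the trace brings [A] next to
    its inverse. *)
Lemma killing_form_automorphism {R : realType} {n : nat}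
    (br : 'rV[R]_n -> 'rV[R]_n -> 'rV[R]_n) (A A' : 'rV[R]_n -> 'rV[R]_n) X Y :
  (forall Z, linear (br Z)) -> linear A -> linear A' ->
  cancel A A' -> cancel A' A -> {morph A : U W / br U W} ->
  killing_form br (A X) (A Y) = killing_form br X Y.
Proof.
move=> lb lA lA' AK A'K Abr.
have E : br (A X) \o br (A Y) = A \o ((br X \o br Y) \o A').
  by apply/funext => W /=; rewrite !Abr A'K.
have lE : linear ((br X \o br Y) \o A').
  by move=> k U W /=; rewrite lA' !lb.
rewrite /killing_form E (lin1_mx_comp _ lA) mxtrace_mulC -(lin1_mx_comp _ lE).
by congr (\tr (lin1_mx _)); apply/funext => W /=; rewrite AK.
Qed.

Lemma killing_formDl {R : realType} {n : nat}
    (br : 'rV[R]_n -> 'rV[R]_n -> 'rV[R]_n) X Y Z :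
  (forall W, br (X + Y) W = br X W + br Y W) ->
  killing_form br (X + Y) Z = killing_form br X Z + killing_form br Y Z.
Proof.
move=> brD; rewrite /killing_form -mxtraceD; congr (\tr _).
by apply/matrixP => i j; rewrite !mxE /= brD mxE.
Qed.

Lemma killing_form_centerl {R : realType} {n : nat}
    (br : 'rV[R]_n -> 'rV[R]_n -> 'rV[R]_n) X Y :
  (forall Z, br X Z = 0) -> killing_form br X Y = 0.
Proof.
move=> X0; rewrite /killing_form (_ : lin1_mx _ = 0) ?mxtrace0//.
by apply/matrixP => i j; rewrite !mxE /= X0 mxE.
Qed.

Section Killing.
Context {R : realType} {n : nat} {G : lieGroupType R n}.
Implicit Types (X Y Z : 'rV[R]_n) (g : G) (c : R -> G).
Local Notation br := (@lie_bracket R n G).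
Local Notation B := (killing_form br).

Lemma killing_form_Ad g X Y : B (Ad g X) (Ad g Y) = B X Y.
Proof.
apply: (@killing_form_automorphism _ _ _ (Ad g) (Ad g^-1%g)).
- exact: lie_bracket_linearr.
- exact: Ad_linear.
- exact: Ad_linear.
- exact: AdK.
- exact: AdVK.
- exact: Ad_bracket.
Qed.

Lemma lie_bracketDl X Y Z : br (X + Y) Z = br X Z + br Y Z.
Proof.
rewrite !(lie_bracketC (G := G) _ Z) -opprD; congr (- _).
by have := lie_bracket_linearr (G := G) Z 1 X Y; rewrite !scale1r.
Qed.

Section CartanInvolution.
Variable theta : G -> G.
Hypothesis theta_cartan : group_cartan_involution theta.

Local Notation phi1 := (cmap (chart_at (1%g : G))).
Local Notation m := (mul_chart (1%g : G)).
Local Notation o := (@origin R n G).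
Local Notation V := 'rV[R]_n.
Local Notation dtheta := (differential1 theta).

Let thetaM : {morph theta : x y / (x * y)%g} := theta_cartan.1.1.1.

Lemma cartan_differentiable_map : differentiable_map theta.
Proof.
by have [[[_ [f [_ _ sf _]]] _] _] := theta_cartan; exact: smooth_differentiable_map.
Qed.

Let ip X Y := - B X (dtheta Y).

Let ip_gt0 X : X != 0 -> 0 < ip X X.
Proof. by have [_ [_ _ _ +]] := theta_cartan; apply. Qed.

Let ipDl X Y Z : ip (X + Y) Z = ip X Z + ip Y Z.
Proof. by rewrite /ip (killing_formDl _ (lie_bracketDl X Y)) opprD. Qed.

Let ip0l Y : ip 0 Y = 0.
Proof. by apply: (addrI (ip 0 Y)); rewrite -ipDl !addr0. Qed.

Let ip_ge0 X : 0 <= ip X X.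
Proof. by have [->|/ip_gt0/ltW//] := eqVneq X 0; rewrite ip0l. Qed.

(** Invariance of the Killing form moves [Ad g] to the other argument as its inverse, which [dtheta]
    turns back into [Ad g] since [theta] inverts [g]. *)
Let ip_Ad g X Y : theta g = g^-1%g -> ip (Ad g X) Y = ip X (Ad g Y).
Proof.
move=> tg.
have T : dtheta (Ad g Y) = Ad g^-1%g (dtheta Y).
  by rewrite (Ad_automorphism _ _ cartan_differentiable_map thetaM) tg.
have K := killing_form_Ad g X (Ad g^-1%g (dtheta Y)); rewrite AdVK in K.
by rewrite /ip T K.
Qed.

(* [v := Ad (g * g) X - X] satisfies Ad(g)^2 v = - v, although Ad(g)^2 is
   positive. *)
Lemma Ad_square_trivial g : theta g = g^-1%g ->
  (forall X, Ad (g * g * (g * g))%g X = X) -> forall X, Ad (g * g)%g X = X.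
Proof.
move=> tg A4 X; apply/eqP; rewrite -subr_eq0; apply: contraT => v0.
set v := _ - X in v0.
have lA (h : G) : linear (Ad h) by exact: Ad_linear.
have AvE : Ad (g * g)%g v + v = 0.
  have := lA (g * g)%g (-1) X (Ad (g * g)%g X).
  rewrite !scaleN1r -AdM A4 ![- _ + _]addrC -/v => ->.
  by rewrite /v -opprB addNr.
have := ipDl (Ad (g * g)%g v) v v.
rewrite AvE ip0l AdM (ip_Ad _ _ tg) => /eqP; rewrite eq_sym paddr_eq0 ?ip_ge0//.
move=> /andP[_ /eqP iv].
by have := ip_gt0 v0; rewrite iv ltxx.
Qed.

Lemma Ad_dyadic_trivial c X (T : R) k : is_psg c X -> dtheta X = - X ->
  c T = 1%g -> forall Y, Ad (c (T / 2 ^+ k)) Y = Y.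
Proof.
move=> cX tX cT; have [cD _ _] := cX.
have tc t : theta (c t) = (c t)^-1%g.
  have := psg_map cartan_differentiable_map thetaM cX; rewrite tX.
  by move=> /psg_unique/(_ (psgN cX) t) /= ->; exact: psgNE cX.
elim: k => [|k IH] Y; first by rewrite expr0 divr1 cT Ad1.
set t := T / 2 ^+ k.+1.
have tE : T / 2 ^+ k = t + t.
  by rewrite /t exprS invfM mulrCA [2^-1 * _]mulrC -splitr.
(* With g = c(t / 2), g^4 is c(t + t), on which [Ad] is trivial by induction, and g^2 is c(t): a
   quarter of the known time serves to reach its half. *)
rewrite (splitr t) cD; apply: Ad_square_trivial; first exact: tc.
by move=> Z; rewrite -cD -splitr -cD -tE IH.
Qed.

(** Along [c], the difference of the left- and right-invariant fields of [Y] has derivative [br X Y]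
    at 0 by [lie_bracketE]. It vanishes at the small times [T / 2 ^+ k], where [Ad] is trivial. *)
Lemma psg_periodic_central c X (T : R) : is_psg c X -> dtheta X = - X ->
  0 < T -> c T = 1%g -> forall Y, br X Y = 0.
Proof.
move=> cX tX T0 cT Y.
have [cD cc dc] := cX; have c0 := psg0 cX.
have oD : mul_dom (1%g : G) (o, o) by apply: mul_dom1; exact: origin_ccod.
have dm (v : V * V) : differentiable ('D_v m) (o, o).
  by apply: ((smooth_mul_chart (1%g : G) 2%N).2 _).1.
have co : (phi1 \o c) 0 = o by rewrite /= c0.
have d1 : is_derive (0 : R) 1 (fun t => 'D_((0, Y) : V * V) m (phi1 (c t), o))
    ('D_((X, 0) : V * V) ('D_((0, Y) : V * V) m) (o, o)).
  have d : differentiable (fun p => 'D_((0, Y) : V * V) m (p, o)) ((phi1 \o c) 0).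
    by rewrite co; apply: (differentiable_pairl (f := 'D_((0, Y) : V * V) m)).
  have := is_derive_curve_comp dc d; rewrite co.
  by rewrite (derive_pairl ('D_((0, Y) : V * V) m)).
have d2 : is_derive (0 : R) 1 (fun t => 'D_((Y, 0) : V * V) m (o, phi1 (c t)))
    ('D_((0, X) : V * V) ('D_((Y, 0) : V * V) m) (o, o)).
  have d : differentiable (fun p => 'D_((Y, 0) : V * V) m (o, p)) ((phi1 \o c) 0).
    by rewrite co; apply: (differentiable_pairr (f := 'D_((Y, 0) : V * V) m)).
  have := is_derive_curve_comp dc d; rewrite co.
  by rewrite (derive_pairr ('D_((Y, 0) : V * V) m)).
have nc : \forall t \near (0 : R), cdom (chart_at (1%g : G)) (c t).
  by apply: cc; apply: near_cdom; rewrite c0; exact: mem_chart_at.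
move: nc => /nbhs_normP[r /= r0 rP].
rewrite lie_bracketE; apply: derive_eq0_of_zeros (is_deriveB d1 d2) _ _.
  apply/eqP; rewrite subr_eq0; apply/eqP.
  by rewrite c0; apply: Ad_id_chart; [exact: mem_chart_at|exact: Ad1].
(* The bound [e] makes the zero close to 0, the bound [r] keeps [c] inside the chart at 1. *)
move=> e e0; have [|k] := @small_dyadic R T (Num.min e r).
  by rewrite lt_min e0.
rewrite lt_min => /andP[ke kr]; exists (T / 2 ^+ k); split => //.
  by rewrite mulf_neq0 ?invr_neq0 ?expf_neq0 ?gt_eqF.
apply/eqP; rewrite subr_eq0; apply/eqP; apply: Ad_id_chart.
  by apply: rP; rewrite /= sub0r normrN.
exact: Ad_dyadic_trivial cX tX cT Y.
Qed.

(** A central [X] is orthogonal to everything for the Killing form, against the definiteness of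
    [ip]. *)
Lemma psg_periodic_trivial c X (T : R) : is_psg c X -> dtheta X = - X ->
  0 < T -> c T = 1%g -> X = 0.
Proof.
move=> cX tX T0 cT; apply/eqP; apply: contraT => /ip_gt0.
rewrite /ip killing_form_centerl ?oppr0 ?ltxx//.
exact: psg_periodic_central cX tX T0 cT.
Qed.

(** A torsion relation makes [k.+1] a period of the one-parameter subgroup, which is then
    constant. *)
Lemma lie_exp_torsion_free X k : dtheta X = - X ->
  (lie_exp G X ^+ k.+1 = 1)%g -> lie_exp G X = 1%g.
Proof.
move=> tX; have [->//|[c cX ->]] := lie_expP (G := G) X => ck.
have [cD _ _] := cX.
have cE j : c j%:R = (c 1%R ^+ j)%g.
  by elim: j => [|j IH]; [rewrite (psg0 cX)|rewrite -natr1 cD IH expgSr].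
have X0 : X = 0.
  by apply: (psg_periodic_trivial cX tX (ltr0Sn R k)); rewrite cE.
by rewrite X0 in cX; rewrite (psg_unique cX psg_cst).
Qed.

End CartanInvolution.
End Killing.

(** * Stabilizers *)

Section Subgroups.
Context {G : groupType}.
Implicit Type S : set G.

Lemma subgroup1 S : is_subgroup S -> S 1%g.
Proof. by move=> [+ _]; rewrite inE. Qed.

Lemma subgroupV S x : is_subgroup S -> S x -> S x^-1%g.
Proof.
by move=> /group_closedV SV Sx; have := SV x; rewrite !inE; apply.
Qed.

Lemma subgroupM S x y : is_subgroup S -> S x -> S y -> S (x * y)%g.
Proof.
by move=> /group_closedM SM Sx Sy; have := SM x y; rewrite !inE; apply.
Qed.

Lemma subgroup_intro S : S 1%g -> (forall x y, S x -> S y -> S (x * y)%g) ->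
  (forall x, S x -> S x^-1%g) -> is_subgroup S.
Proof.
move=> S1 SM SV; split; first by rewrite inE.
by move=> x y; rewrite !inE => Sx Sy; apply: SM => //; exact: SV.
Qed.

Context {M : Type} (act : G -> M -> M).
Hypothesis act1 : forall a, act 1%g a = a.
Hypothesis actM : forall x y a, act (x * y)%g a = act x (act y a).

Lemma setwise_stabilizer_subgroup S A :
  is_subgroup S -> is_subgroup (setwise_stabilizer act S A).
Proof.
move=> Sg; apply: subgroup_intro.
- split; first exact: subgroup1.
  by under eq_imagel do rewrite act1; rewrite image_id.
- move=> x y [Sx xA] [Sy yA]; split; first exact: subgroupM.
  by under eq_imagel do rewrite actM; rewrite -image_comp yA xA.
- move=> x [Sx xA]; split; first exact: subgroupV.
  (* [A] is rewritten as its own image under [x], on which the inverse of [x] cancels. *)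
  rewrite -[in LHS]xA image_comp -[RHS]image_id; apply: eq_imagel => a _ /=.
  by rewrite -actM mulVg act1.
Qed.

Lemma pointwise_stabilizer_subgroup S A :
  is_subgroup S -> is_subgroup (pointwise_stabilizer act S A).
Proof.
move=> Sg; apply: subgroup_intro.
- by split; [exact: subgroup1|].
- move=> x y [Sx xA] [Sy yA]; split; first exact: subgroupM.
  by move=> a Aa; rewrite actM yA// xA.
- move=> x [Sx xA]; split; first exact: subgroupV.
  by move=> a Aa; rewrite -{1}(xA a Aa) -actM mulVg act1.
Qed.

End Subgroups.

(** The first projection undoes the diagonal and is multiplicative everywhere. *)
Lemma isomorphic_diagonal {G : groupType} (P : set (G * G)) (Q : set G) :
  is_subgroup P -> is_subgroup Q -> (fun g => (g, g)) @` Q = P ->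
  isomorphic_subgroups P Q.
Proof.
move=> Pg Qg QP; split => //; exists fst; last by move=> x y _ _.
rewrite -QP; split.
- by move=> _ [x Qx <-].
- by move=> x y /set_mem[a Qa <-] /set_mem[b Qb <-] /= ->.
- by move=> x Qx; exists (x, x) => //; exists x.
Qed.

Theorem theorem4p3 (R : realType) (n : nat) (G : lieGroupType R n)
    (sigma theta : G -> G) (H K KH A : set G) (a0 : {vspace 'rV[R]_n})
    (Gss : semisimple_lie_group G)
    (Gnc : ~ compact [set: G])
    (sigma_inv : involutive_automorphism sigma)
    (H_group : is_subgroup H)
    (H_closed : closed H)
    (H_ge : connected_component (fixed_points sigma) 1%g `<=` H)
    (H_le : H `<=` fixed_points sigma)
    (theta_cartan : group_cartan_involution theta)
    (theta_sigma : forall x, theta (sigma x) = sigma (theta x))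
    (K_def : K = fixed_points theta)
    (K_connected : connected K)
    (K_maxcompact : maximal_compact_subgroup K)
    (KH_def : KH = K `&` H)
    (a0_max : maximal_abelian_in (@lie_bracket R n G)
                (minus_eigenspace theta `&` minus_eigenspace sigma) a0)
    (A_def : A = @lie_exp R n G @` [set` a0]) :
  let Delta := fun g : G => (g, g) in
  let N_KxH := setwise_stabilizer (@two_sided_action R n G) (K `*` H) A in
  let Z_KxH := pointwise_stabilizer (@two_sided_action R n G) (K `*` H) A in
  let N_KH := setwise_stabilizer (@conjugation_action R n G) KH A in
  let Z_KH := pointwise_stabilizer (@conjugation_action R n G) KH A in
  [/\ Delta @` N_KH = N_KxH,
      isomorphic_subgroups N_KxH N_KH &
      isomorphic_subgroups Z_KxH Z_KH].

Proof.
move=> Delta N_KxH Z_KxH N_KH Z_KH.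
have [[thM _] thI] := theta_cartan.1; have [[siM _] siI] := sigma_inv.
have dth : differentiable_map theta := cartan_differentiable_map theta_cartan.
have dsi : differentiable_map sigma.
  by have [[_ [f [_ _ sf _]]] _] := sigma_inv; exact: smooth_differentiable_map.
have a0p X : X \in a0 -> differential1 theta X = - X /\ differential1 sigma X = - X.
  by move=> Xa; have [+ _ _] := a0_max; apply.
have A1 : A 1%g by rewrite A_def; exists 0; [exact: mem0v|exact: lie_exp0].
have key k h : K k -> H h -> A (k * h^-1)%g -> k = h.
  rewrite K_def A_def => Kk /H_le Hh [X Xa aE].
  have [tX sX] := a0p X Xa.
  have ta := lie_exp_inv dth thM tX; have sa := lie_exp_inv dsi siM sX.
  set a := lie_exp G X in aE ta sa.
  have kE : k = (a * h)%g by rewrite aE mulgVK.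
  have skE : sigma k = (a^-1 * h)%g by rewrite kE siM sa Hh.
  have a2 : theta (a * a)%g = (a * a)%g.
    have -> : (a * a)%g = (k * (sigma k)^-1)%g.
      by rewrite skE kE invgM invgK !mulgA mulgK.
    by rewrite thM groupmorphV// theta_sigma Kk.
  have a1 : a = 1%g.
    (* The exponent in the lemma is [k.+1], so 3 stands for the fourth power. *)
    apply: (lie_exp_torsion_free theta_cartan (k := 3) tX); rewrite -/a.
    have : (a * a * (a * a) = 1)%g.
      (* One copy of a^2 is replaced by its image under [theta], which is also its inverse. *)
      by rewrite -{1}a2 thM ta -invgM mulVg.
    by rewrite !expgS expg0 !mulgA mulg1.
  by rewrite kE a1 mul1g.
have K_group : is_subgroup K by case: K_maxcompact.
have KH_group : is_subgroup KH.
  rewrite KH_def; apply: subgroup_intro.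
  - by split; exact: subgroup1.
  - by move=> x y [? ?] [? ?]; split; exact: subgroupM.
  - by move=> x [? ?]; split; exact: subgroupV.
have KxH_group : is_subgroup (K `*` H : set (G * G)).
  apply: subgroup_intro.
  - by split; exact: subgroup1.
  - by move=> x y [? ?] [? ?]; split; exact: subgroupM.
  - by move=> x [? ?]; split; exact: subgroupV.
have act1 a : two_sided_action (1%g : G * G) a = a.
  by rewrite /two_sided_action /= mul1g invg1 mulg1.
have actM (x y : G * G) a :
    two_sided_action (x * y)%g a = two_sided_action x (two_sided_action y a).
  by rewrite /two_sided_action /= invgM !mulgA.
have conj1 (a : G) : conjugation_action 1%g a = a.
  by rewrite /conjugation_action mul1g invg1 mulg1.
have conjM (x y a : G) :
    conjugation_action (x * y)%g a = conjugation_action x (conjugation_action y a).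
  by rewrite /conjugation_action invgM !mulgA.
have N_eq : Delta @` N_KH = N_KxH.
  apply/seteqP; split=> [_ [g [+ gA] <-]|[k h] [[/= Kk Hh] khA]].
    (* At [(g, g)] the two-sided action unfolds to conjugation by [g], so [gA] serves unchanged. *)
    by rewrite KH_def => -[Kg Hg]; split.
  have khE : k = h.
    apply: key => //; rewrite -khA; exists 1%g => //.
    by rewrite /two_sided_action /= mulg1.
  by subst h; exists k => //; split=> //; rewrite KH_def.
have Z_eq : Delta @` Z_KH = Z_KxH.
  apply/seteqP; split=> [_ [g [+ gA] <-]|[k h] [[/= Kk Hh] khA]].
    by rewrite KH_def => -[Kg Hg]; split.
  have khE : k = h.
    (* Here [(k, h)] fixes the element 1 of [A], so k h^-1 is 1 itself. *)
    apply: key => //; rewrite -[k]mulg1 -/(two_sided_action (k, h) 1%g).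
    by rewrite khA.
  by subst h; exists k => //; split=> //; rewrite KH_def.
split => //; apply: isomorphic_diagonal => //.
- exact: setwise_stabilizer_subgroup.
- exact: setwise_stabilizer_subgroup.
- exact: pointwise_stabilizer_subgroup.
- exact: pointwise_stabilizer_subgroup.
Qed.
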